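(* Let $G_{1,1}$ be the group with presentation $\langle a,b,c,d,s,t \mid c=ab=ba,\ d=ab^{-1},\ s^{-1}as=c,\ t^{-1}at=d\rangle$ and let $X=\{a^{\pm1},b^{\pm1},c^{\pm1},d^{\pm1},s^{\pm1},t^{\pm1}\}$. Then the language of all geodesic words in $X^*$ for $(G_{1,1},X)$ is not regular.
   Context: $X^*$ denotes the set of all finite words in the letters of $X$, including the empty word. A word $w\in X^*$ is geodesic for $(G_{1,1},X)$ if no word in $X^*$ representing the same element of $G_{1,1}$ has fewer letters; equivalently, the path labelled $w$ from the identity in the Cayley graph $\Gamma(G_{1,1},X)$ (edges of length 1) is a shortest path between its endpoints. A language $L\subseteq X^*$ is regular if it is the set of words accepted by some finite state automaton. *)

(* Defs.v *)
From HB Require Import structures.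
From mathcomp Require Import all_boot.
From mathcomp Require Import boolp.

Set Implicit Arguments.
Unset Strict Implicit.
Unset Printing Implicit Defensive.

Local Open Scope quotient_scope.

(* The letter (x, false) stands for the generator x, and (x, true) for its
   formal inverse. *)
Definition letter (T : Type) := (T * bool)%type.
Definition word (T : Type) := seq (letter T).

Definition linv (T : Type) (l : letter T) : letter T := (l.1, ~~ l.2).
Definition winv (T : Type) (w : word T) : word T := rev (map (@linv T) w).

(* The congruence on words whose classes are the elements of < T | u = v for
   (u, v) in R >, the product being induced by concatenation. *)
Inductive pres_eq (T : eqType) (R : seq (word T * word T)) :
    word T -> word T -> Prop :=
| pres_refl u : pres_eq R u u
| pres_sym u v : pres_eq R u v -> pres_eq R v u
| pres_trans u v w : pres_eq R u v -> pres_eq R v w -> pres_eq R u w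
| pres_cat u u' v v' :
    pres_eq R u u' -> pres_eq R v v' -> pres_eq R (u ++ v) (u' ++ v')
| pres_cancel l : pres_eq R [:: l; linv l] [::]
| pres_rel u v : (u, v) \in R -> pres_eq R u v.

Section PresentedGroup.
Variables (T : choiceType) (R : seq (word T * word T)).

Definition pres_eqb (u v : word T) : bool := `[< pres_eq R u v >].

Lemma pres_eqb_refl : reflexive pres_eqb.
Proof. by move=> u; apply/asboolP; exact: pres_refl. Qed.

Lemma pres_eqb_sym : symmetric pres_eqb.
Proof. by move=> u v; apply/asboolP/asboolP; exact: pres_sym. Qed.

Lemma pres_eqb_trans : transitive pres_eqb.
Proof.
by move=> v u w /asboolP uv /asboolP vw; apply/asboolP; exact: pres_trans vw.
Qed.

Canonical pres_equiv := EquivRel pres_eqb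
  pres_eqb_refl pres_eqb_sym pres_eqb_trans.

Definition presented_group := {eq_quot pres_equiv}.

HB.instance Definition _ := Choice.on presented_group.
HB.instance Definition _ := EqQuotient.on presented_group.

Definition pres_class (u : word T) : presented_group := \pi_presented_group u.

Implicit Types x y z : presented_group.

Lemma pres_classK : cancel repr pres_class.
Proof. exact: reprK. Qed.

Lemma pres_classP u v : pres_class u = pres_class v <-> pres_eq R u v.
Proof. by split=> [/eqmodP/asboolP|uv] //; apply/eqmodP/asboolP. Qed.

Definition pres_one : presented_group := pres_class [::].
Definition pres_mul x y : presented_group := pres_class (repr x ++ repr y).
Definition pres_inv x : presented_group := pres_class (winv (repr x)).

Lemma pres_repr u : pres_eq R (repr (pres_class u)) u.
Proof. by apply/pres_classP; rewrite pres_classK. Qed.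

Lemma pres_mul_class u v : pres_mul (pres_class u) (pres_class v) = pres_class (u ++ v).
Proof. by apply/pres_classP; apply: pres_cat; apply: pres_repr. Qed.

Lemma linvK : involutive (@linv T).
Proof. by case=> x e; rewrite /linv /= negbK. Qed.

Lemma winvK : involutive (@winv T).
Proof.
by move=> w; rewrite /winv map_rev revK -map_comp map_id_in // => l _; apply: linvK.
Qed.

Lemma pres_catV w : pres_eq R (w ++ winv w) [::].
Proof.
elim: w => [|l w IHw]; first exact: pres_refl.
rewrite /winv /= rev_cons -/(winv w) -cats1 catA.
apply: pres_trans (pres_cancel R l).
by have := pres_cat (pres_refl R [:: l]) (pres_cat IHw (pres_refl R [:: linv l])).
Qed.

Lemma pres_mulA : associative pres_mul.
Proof.
by move=> x y z; rewrite -[x]pres_classK -[y]pres_classK -[z]pres_classK !pres_mul_class catA.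
Qed.

Lemma pres_mul1g : left_id pres_one pres_mul.
Proof. by move=> x; rewrite -[x]pres_classK pres_mul_class. Qed.

Lemma pres_mulg1 : right_id pres_one pres_mul.
Proof. by move=> x; rewrite -[x]pres_classK pres_mul_class cats0. Qed.

Lemma pres_mulgV : right_inverse pres_one pres_inv pres_mul.
Proof.
by move=> x; rewrite -[X in pres_mul X _]pres_classK pres_mul_class; apply/pres_classP/pres_catV.
Qed.

Lemma pres_mulVg : left_inverse pres_one pres_inv pres_mul.
Proof.
move=> x; rewrite -[X in pres_mul _ X]pres_classK pres_mul_class; apply/pres_classP.
by rewrite -[X in _ ++ X]winvK; apply: pres_catV.
Qed.

HB.instance Definition _ := isGroup.Build presented_group
  pres_mulA pres_mul1g pres_mulg1 pres_mulVg pres_mulgV.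

Definition pres_gen (x : T) : presented_group := pres_class [:: (x, false)].

End PresentedGroup.

Section Words.
Local Open Scope group_scope.

Definition letter_val (T : Type) (G : groupType) (f : T -> G) (l : letter T) : G :=
  if l.2 then (f l.1)^-1 else f l.1.

Definition word_val (T : Type) (G : groupType) (f : T -> G) (w : word T) : G :=
  \big[*%g/1]_(l <- w) letter_val f l.

Definition geodesic (T : Type) (G : groupType) (f : T -> G) (w : word T) : Prop :=
  forall v : word T, word_val f v = word_val f w -> (size w <= size v)%N.

Lemma pres_word_val (T : choiceType) (R : seq (word T * word T)) (w : word T) :
  word_val (@pres_gen T R) w = pres_class R w.
Proof.
elim: w => [|[x e] w IHw]; first by rewrite /word_val big_nil.
rewrite /word_val big_cons -/(word_val _ _) IHw.
have -> : letter_val (@pres_gen T R) (x, e) = pres_class R [:: (x, e)].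
  case: e => //; rewrite /letter_val /=.
  have /= xV : pres_gen R x * pres_class R [:: (x, true)] = 1.
    by apply: etrans (pres_mul_class _ _ _) _; apply/pres_classP/(pres_cancel R (x, false)).
  by rewrite -[LHS]mulg1 -xV mulKg.
exact: pres_mul_class.
Qed.

Lemma pres_word_valP (T : choiceType) (R : seq (word T * word T)) (u v : word T) :
  word_val (@pres_gen T R) u = word_val (@pres_gen T R) v <-> pres_eq R u v.
Proof. by rewrite !pres_word_val; apply: pres_classP. Qed.

Lemma pres_eq_word_val (T : choiceType) (R : seq (word T * word T))
    (G : groupType) (f : T -> G) :
  (forall u v, (u, v) \in R -> word_val f u = word_val f v) ->
  forall u v, pres_eq R u v -> word_val f u = word_val f v.
Proof.
move=> fR u v; elim=> //.
- by move=> {}u {}v w _ -> _.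
- by move=> {}u u' {}v v' _ uu' _ vv'; rewrite /word_val !big_cat /= -!/(word_val _ _) uu' vv'.
- case=> x e; rewrite /word_val !big_cons !big_nil mulg1 /letter_val /=.
  by case: e; rewrite ?mulgV ?mulVg.
Qed.

End Words.

Record dfa (A : Type) : Type := DFA {
  dfa_state : finType;
  dfa_start : dfa_state;
  dfa_final : {pred dfa_state};
  dfa_step : dfa_state -> A -> dfa_state }.

Definition dfa_accept (A : Type) (M : dfa A) (w : seq A) : bool :=
  foldl (@dfa_step A M) (@dfa_start A M) w \in @dfa_final A M.

Definition regular (A : Type) (L : seq A -> Prop) : Prop :=
  exists M : dfa A, forall w : seq A, L w <-> dfa_accept M w.

Inductive gen11 : Set := gen_a | gen_b | gen_c | gen_d | gen_s | gen_t.

Definition gen11_to_ord (x : gen11) : 'I_6 :=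
  inord match x with
        | gen_a => 0 | gen_b => 1 | gen_c => 2 | gen_d => 3 | gen_s => 4 | gen_t => 5
        end.
Definition gen11_of_ord (i : 'I_6) : gen11 :=
  nth gen_a [:: gen_a; gen_b; gen_c; gen_d; gen_s; gen_t] i.

Lemma gen11_to_ordK : cancel gen11_to_ord gen11_of_ord.
Proof. by case; rewrite /gen11_of_ord inordK. Qed.

HB.instance Definition _ := Finite.copy gen11 (can_type gen11_to_ordK).

Local Notation pos x := (x, false).
Local Notation neg x := (x, true).

Definition G11_rels : seq (word gen11 * word gen11) :=
  [:: ([:: pos gen_c], [:: pos gen_a; pos gen_b]);
      ([:: pos gen_a; pos gen_b], [:: pos gen_b; pos gen_a]);
      ([:: pos gen_d], [:: pos gen_a; neg gen_b]);
      ([:: neg gen_s; pos gen_a; pos gen_s], [:: pos gen_c]);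
      ([:: neg gen_t; pos gen_a; pos gen_t], [:: pos gen_d])].

Definition G11 : groupType := presented_group G11_rels.

Definition G11_gen (x : gen11) : G11 := pres_gen G11_rels x.

(* Main.v *)
Require Import Defs.
From mathcomp Require Import all_boot.
From mathcomp Require Import all_order all_algebra.
From mathcomp Require Import zify lra.

(** The words [d^M t^-(k+1) b] already show that no automaton can recognise
    geodesics: such a word is geodesic when [M < 2^k] and is not when
    [M = 2^k], so an automaton would have to tell apart all the prefixes
    [d^(2^i)].

    Shortening when [M = 2^k].  Since [a^2 = cd] and [d t^-1 = t^-1 a],
    [d^(2m) t^-1 = t^-1 a^(2m) = t^-1 c^m d^m].  Every [t^-1] crossed in this way
    halves the power of [d] without changing the number of letters, until a
    single [a] stands next to the final [b]; then [ab = c] saves a letter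
    ([dpow_tail]).

    Minimality when [M < 2^k].  The group acts on the right on triples
    [(x, y, h)] of rational numbers: [a] and [b] translate [(x, y)] by [(1, 0)]
    and [(0, 1)], hence [c] by [(1, 1)] and [d] by [(1, -1)], while [s] maps
    [(x, y)] to [(x, y + x)] and [t] maps [(x, y)] to [(x, 2y - x)]; the height
    [h] counts the exponent of [t].  The function [h - x + e], where [e] is 1 if
    [y < x] and 0 otherwise, drops by at most 1 under each letter
    ([potential_step]): moving along [a], [c] or [d] can only make the condition
    [y < x] true, so that a change of [e] offsets that of [- x]; [t] preserves
    the condition, and [b] and [s] can change nothing but [e].  Hence
    the length of a word is bounded below by the drop of this function along it,
    whichever word represents the element.  Along [d^M t^-(k+1) b], starting from a
    well-chosen triple, every letter makes it drop by exactly 1: [d] and [t^-1]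
    through [- x] and [h], and the final [b] because it destroys the condition
    [y < x].  Halving [y] with each [t^-1] is what makes [2^k] the threshold. *)

Set Implicit Arguments.
Unset Strict Implicit.
Unset Printing Implicit Defensive.

Import Order.TTheory GRing.Theory Num.Theory.

(** * Words, automata and right actions *)

Section WordValues.
Local Open Scope group_scope.
Variables (T : Type) (G : groupType) (f : T -> G).

Lemma word_val_cat u v : word_val f (u ++ v) = word_val f u * word_val f v.
Proof. by rewrite /word_val big_cat. Qed.

Lemma word_val_cons l u : word_val f (l :: u) = letter_val f l * word_val f u.
Proof. by rewrite /word_val big_cons. Qed.

Lemma word_val_nil : word_val f [::] = 1.
Proof. by rewrite /word_val big_nil. Qed.

Lemma word_val_nseq n l : word_val f (nseq n l) = letter_val f l ^+ n.
Proof.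
elim: n => [|n IHn]; first by rewrite word_val_nil expg0.
by rewrite /= word_val_cons IHn expgS.
Qed.

End WordValues.

(** The universal property of the presentation for right actions on a set,
    which avoids turning the action into a morphism to a group of bijections. *)
Lemma pres_eq_foldl (T : eqType) (R : seq (word T * word T)) (S : Type)
    (act : S -> letter T -> S) :
  (forall p l, act (act p l) (linv l) = p) ->
  (forall u v, (u, v) \in R -> forall p, foldl act p u = foldl act p v) ->
  forall u v, pres_eq R u v -> forall p, foldl act p u = foldl act p v.
Proof.
move=> actK actR u v; elim=> //=.
- by move=> {}u {}v w _ uv _ vw p; rewrite uv.
- by move=> {}u u' {}v v' _ uu' _ vv' p; rewrite !foldl_cat uu' vv'.
Qed.

(** By the pigeonhole principle, an automaton confuses two of infinitely many
    prefixes. *)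
Lemma regular_confuses (A : Type) (L : seq A -> Prop) (u : nat -> seq A) :
  regular L ->
  exists i j, (i < j)%N /\ forall w, L (u i ++ w) <-> L (u j ++ w).
Proof.
case=> M ML; pose q (i : 'I_#|dfa_state M|.+1) :=
  foldl (@dfa_step A M) (@dfa_start A M) (u i).
have: ~~ injectiveb q.
  by apply/injectiveP=> /leq_card; rewrite card_ord ltnn.
case/injectivePn=> i [j neq_ij eq_q].
have same (i' j' : 'I_#|dfa_state M|.+1) (eq_q' : q i' = q j') w :
    L (u i' ++ w) <-> L (u j' ++ w).
  by rewrite !ML /dfa_accept !foldl_cat -/(q i') -/(q j') eq_q'.
case: (ltngtP i j) => [lt_ij|lt_ji|eq_ij].
- by exists i, j; split=> //; apply: same.
- by exists j, i; split=> //; apply: same.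
- by move: neq_ij; rewrite (val_inj eq_ij) eqxx.
Qed.

(** * An affine action and a potential *)

Section Action.
Local Open Scope ring_scope.

Definition act11 (p : rat * rat * rat) (l : letter gen11) : rat * rat * rat :=
  let: (x, y, h) := p in
  match l with
  | (gen_a, false) => (x + 1, y, h)
  | (gen_a, true) => (x - 1, y, h)
  | (gen_b, false) => (x, y + 1, h)
  | (gen_b, true) => (x, y - 1, h)
  | (gen_c, false) => (x + 1, y + 1, h)
  | (gen_c, true) => (x - 1, y - 1, h)
  | (gen_d, false) => (x + 1, y - 1, h)
  | (gen_d, true) => (x - 1, y + 1, h)
  | (gen_s, false) => (x, y + x, h)
  | (gen_s, true) => (x, y - x, h)
  | (gen_t, false) => (x, y * 2 - x, h + 1)
  | (gen_t, true) => (x, (y + x) / 2, h - 1)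
  end.

Lemma act11K p l : act11 (act11 p l) (linv l) = p.
Proof.
by case: p => [[x y] h]; case: l => [[] []]; rewrite /linv /=;
   congr (_, _, _); lra.
Qed.

Lemma act11_rels u v : (u, v) \in G11_rels ->
  forall p, foldl act11 p u = foldl act11 p v.
Proof.
rewrite !inE => /or4P[||| /orP[]] /eqP[-> ->] [[x y] h] //=;
  by congr (_, _, _); lra.
Qed.

Definition potential (p : rat * rat * rat) : rat :=
  p.2 - p.1.1 + (p.1.2 < p.1.1)%R%:R.

Lemma potential_step p l : potential p <= potential (act11 p l) + 1.
Proof.
case: p => [[x y] h]; case: l => [[] []]; rewrite /potential /=;
  by case: (ltP y x) => ?; case: ltP => ? /=; lra.
Qed.

Lemma potential_foldl w p :
  potential p <= potential (foldl act11 p w) + (size w)%:R.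
Proof.
elim: w p => [|l w IHw] p /=; first by rewrite addr0.
apply: le_trans (potential_step p l) _.
by rewrite -[in (size w).+1]addn1 natrD addrA lerD2r.
Qed.

(** All words for the same element lead a given starting point to the same end,
    hence undergo the same drop of potential, at most one unit per letter. *)
Lemma potential_geodesic w p :
  potential (foldl act11 p w) + (size w)%:R <= potential p ->
  geodesic G11_gen w.
Proof.
move=> drop_w v /pres_word_valP/(pres_eq_foldl act11K act11_rels) vw.
rewrite -(ler_nat rat) -(lerD2l (potential (foldl act11 p w))).
by apply: le_trans drop_w _; rewrite -vw potential_foldl.
Qed.

Lemma foldl_act11_d n x y h :
  foldl act11 (x, y, h) (nseq n (gen_d, false)) = (x + n%:R, y - n%:R, h).
Proof.
elim: n x y => [|n IHn] x y /=; first by congr (_, _, _); lra.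
by rewrite IHn -[in n.+1]addn1 natrD; congr (_, _, _); lra.
Qed.

Lemma foldl_act11_tV n y h :
  foldl act11 (0, y, h) (nseq n (gen_t, true)) = (0, y / 2 ^+ n, h - n%:R).
Proof.
elim: n y h => [|n IHn] y h /=.
  by rewrite expr0 divr1 subr0.
rewrite IHn addr0 exprS invfM mulrA -[in n.+1]addn1 natrD.
by congr (_, _, _); lra.
Qed.

End Action.

(** * The test words *)

(** The exponent of [t^-1] is [k + 1] so that the threshold for [M] is [2^k]. *)
Definition test_tail (k : nat) : word gen11 :=
  nseq k.+1 (gen_t, true) ++ [:: (gen_b, false)].

Lemma geodesic_test M k : (M < 2 ^ k)%N ->
  geodesic G11_gen (nseq M (gen_d, false) ++ test_tail k).
Proof.
move=> ltMk.
(* After [d^M] the orbit is at [(0, - 2^(k+1))], and after the powers of [t^-1]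
   at [(0, -1)], the lowest point with [x = 0] that [b] moves out of the
   half-plane [y < x].  This leaves the most room for [d^M] inside it. *)
pose y : rat := (- 2 ^+ k.+1)%R.
apply: (@potential_geodesic _ (- M%:R, y + M%:R, 0)%R).
rewrite !foldl_cat foldl_act11_d addrK addNr foldl_act11_tV /=.
have ->: (y / 2 ^+ k.+1 = - 1 :> rat)%R.
  by rewrite /y mulNr divff // expf_neq0.
have lt_y : (y + M%:R < - M%:R :> rat)%R.
  have: (M%:R < 2 ^+ k :> rat)%R by rewrite -natrX ltr_nat.
  by rewrite /y exprS; lra.
rewrite /potential /= lt_y !size_cat !size_nseq /=.
by rewrite addn1 -[in k.+2]addn1 !natrD; lra.
Qed.

Section Shortening.
Local Open Scope group_scope.

Local Notation a := (G11_gen gen_a).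
Local Notation b := (G11_gen gen_b).
Local Notation c := (G11_gen gen_c).
Local Notation d := (G11_gen gen_d).
Local Notation t := (G11_gen gen_t).

Lemma G11_rel u v : (u, v) \in G11_rels ->
  word_val G11_gen u = word_val G11_gen v.
Proof. by move=> uv; apply/pres_word_valP/pres_rel. Qed.

Lemma G11_c : c = a * b.
Proof.
have/G11_rel: ([:: (gen_c, false)],
               [:: (gen_a, false); (gen_b, false)]) \in G11_rels.
  by rewrite !inE eqxx ?orbT.
by rewrite !word_val_cons word_val_nil !mulg1.
Qed.

Lemma G11_ab : commute a b.
Proof.
have/G11_rel: ([:: (gen_a, false); (gen_b, false)],
               [:: (gen_b, false); (gen_a, false)]) \in G11_rels.
  by rewrite !inE eqxx ?orbT.
by rewrite !word_val_cons word_val_nil !mulg1.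
Qed.

Lemma G11_d : d = a * b^-1.
Proof.
have/G11_rel: ([:: (gen_d, false)],
               [:: (gen_a, false); (gen_b, true)]) \in G11_rels.
  by rewrite !inE eqxx ?orbT.
by rewrite !word_val_cons word_val_nil !mulg1.
Qed.

Lemma G11_t : d = a ^ t.
Proof.
have/G11_rel: ([:: (gen_t, true); (gen_a, false); (gen_t, false)],
               [:: (gen_d, false)]) \in G11_rels.
  by rewrite !inE eqxx ?orbT.
by rewrite !word_val_cons word_val_nil !mulg1 /letter_val /= conjgE => ->.
Qed.

Lemma dpow_tV n : d ^+ n * t^-1 = t^-1 * a ^+ n.
Proof. by rewrite G11_t -conjXg conjgE !mulgA mulgK. Qed.

Lemma commute_cd : commute c d.
Proof.
rewrite G11_c G11_d; have ab := G11_ab.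
have aV : commute a b^-1 by apply: commuteV.
apply: commute_sym; apply: commuteM; apply: commute_sym; apply: commuteM => //.
by apply: commuteV.
Qed.

Lemma apow_double m : a ^+ (m * 2) = c ^+ m * d ^+ m.
Proof.
rewrite -expgMn; last exact: commute_cd.
have -> : c * d = a ^+ 2.
  by rewrite G11_c G11_d mulgA -(mulgA a) -G11_ab mulgA mulgK.
by rewrite mulnC expgnA.
Qed.

(** Pushing each [t^-1] to the left across a power of [a^2 = cd] leaves half of
    it behind as a power of [c], at no cost in letters, and ends with a single
    [a], ready to merge with a following [b]. *)
Lemma dpow_tail k : exists2 v : word gen11, size v = (2 ^ k + k)%N &
  d ^+ (2 ^ k) * t^-1 ^+ k.+1 = word_val G11_gen v * a.
Proof.
elim: k => [|k [v sz_v def_v]].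
  exists [:: (gen_t, true)] => //.
  by rewrite !word_val_cons word_val_nil mulg1 dpow_tV.
exists ((gen_t, true) :: nseq (2 ^ k) (gen_c, false) ++ v).
  by rewrite /= size_cat size_nseq sz_v expnS; lia.
rewrite word_val_cons word_val_cat word_val_nseq -!mulgA -def_v.
by rewrite expgS [LHS]mulgA dpow_tV expnSr apow_double !mulgA.
Qed.

Lemma not_geodesic_test k :
  ~ geodesic G11_gen (nseq (2 ^ k) (gen_d, false) ++ test_tail k).
Proof.
have [v sz_v def_v] := dpow_tail k.
move/(_ (v ++ [:: (gen_c, false)])).
rewrite !word_val_cat !word_val_nseq !word_val_cons word_val_nil !mulg1 /letter_val /=.
rewrite mulgA def_v -mulgA -G11_c => /(_ erefl).
by rewrite !size_cat !size_nseq sz_v /=; lia.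
Qed.

End Shortening.

Theorem theorem8p1 : ~ regular (geodesic G11_gen).
Proof.
case/(regular_confuses (fun i => nseq (2 ^ i) (gen_d, false))) => i [j [lt_ij]].
move/(_ (test_tail j)) => [+ _] => /(_ _)/not_geodesic_test; apply.
by apply: geodesic_test; rewrite ltn_exp2l.
Qed.
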